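(* Let $(\mathfrak{H},\mathcal{J},\mathcal{M},\{\mathcal{S}_\varepsilon\}_{\varepsilon>0})$ satisfy the differential-structure, scaling-structure and multiscale-material-coefficient hypotheses stated in the context, let $\alpha>0$, and let $\mathcal{M}_\varepsilon$, $\mathcal{M}_0$, $\Pi_0$ be as defined there. Put $$\mathcal{A}_\varepsilon=\mathcal{J}+\mathcal{M}_\varepsilon+\alpha I,\qquad \mathcal{A}_0=\mathcal{J}+\mathcal{M}_0+\alpha I .$$ Let $f\in\operatorname{ran}\Pi_0$. Then $$\lim_{\varepsilon\to0}\Pi_0\big(\mathcal{A}_\varepsilon^{-1}-\mathcal{A}_0^{-1}\big)f=0 .$$
   Context: Differential structure: $\mathfrak{H}$ is a Hilbert space and $\mathcal{J}:\operatorname{dom}\mathcal{J}\subset\mathfrak{H}\to\mathfrak{H}$ is closed, densely defined and skew-adjoint ($\mathcal{J}^*=-\mathcal{J}$). Scaling structure: $\{\mathcal{S}_\varepsilon\}_{\varepsilon>0}$ is a family of unitary operators on $\mathfrak{H}$ such that there exist closed, densely defined, skew-adjoint operators $\mathcal{J}_{\mathrm{macro}}$, $\mathcal{J}_{\mathrm{micro}}$ on $\mathfrak{H}$ with $[\mathcal{J}_{\mathrm{macro}},\mathcal{J}_{\mathrm{micro}}]=0$ and $\mathcal{S}_\varepsilon^{-1}\mathcal{J}\mathcal{S}_\varepsilon=\mathcal{J}_{\mathrm{macro}}+\frac1\varepsilon\mathcal{J}_{\mathrm{micro}}$; moreover $\mathcal{S}_\varepsilon$ acts as the identity on $\ker(\mathcal{J}_{\mathrm{micro}})$.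 Projections (a projection and its range are denoted by the same symbol): $\Pi_{\mathrm{grad}}$ is the orthogonal projection onto $\overline{\operatorname{ran}(\mathcal{J}_{\mathrm{micro}})}$; $\mathcal{P}_0$ is the orthogonal projection onto $\ker(\mathcal{J}_{\mathrm{micro}})$; $\Pi_0$ is the orthogonal projection onto the (closure of the) subspace $\{u\in\mathcal{P}_0:\mathcal{J}_{\mathrm{macro}}u\in\mathcal{P}_0\}$; $\Pi_{\mathrm{fluct}}=\mathcal{P}_0-\Pi_0$. Multiscale material coefficients: $\mathcal{M}$ is an operator on $\mathfrak{H}$ and there are $M_\square>0$, $m_\square\ge0$ with $\|\mathcal{M}\|_{\mathfrak{H}\to\mathfrak{H}}\le M_\square$ and $\operatorname{Re}\langle\mathcal{M}u,u\rangle\ge m_\square\|u\|^2$ for all $u\in\mathfrak{H}$. One defines $$\mathcal{M}_0=\Pi_0\mathcal{M}\Pi_0-\Pi_0\mathcal{M}\Pi_{\mathrm{fluct}}(\Pi_{\mathrm{fluct}}\mathcal{M}\Pi_{\mathrm{fluct}}+\alpha I)^{-1}\Pi_{\mathrm{fluct}}\mathcal{M}\Pi_0,\qquad \mathcal{M}_\varepsilon=\mathcal{S}_\varepsilon\mathcal{M}\mathcal{S}_\varepsilon^{-1}.$$ *)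

(* Defs.v *)
From HB Require Import structures.
From mathcomp Require Import all_boot all_order all_algebra.
From mathcomp Require Import all_classical all_reals all_analysis.
From mathcomp Require Import complex.

Set Implicit Arguments.
Unset Strict Implicit.
Unset Printing Implicit Defensive.

Import Order.TTheory GRing.Theory Num.Theory.
Import numFieldNormedType.Exports.

Local Open Scope classical_set_scope.
Local Open Scope ring_scope.
Local Open Scope complex_scope.

(* The form [inner] is linear in its first argument and conjugate-linear in
   its second one. *)
HB.mixin Record CompleteNormedModule_isHilbert (R : realType) H
    of CompleteNormedModule R[i] H := {
  inner : {dot H for @Num.conj R[i]};
  inner_normE : forall u : H, inner u u = `|u| ^+ 2
}.

#[short(type="hilbertType")]
HB.structure Definition Hilbert (R : realType) :=
  { H of CompleteNormedModule_isHilbert R H & CompleteNormedModule R[i] H }.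

(* A partially defined operator: the values of [op_fun] outside of [dom] are
   irrelevant, so operators are compared through their graphs. *)
Record operator (H : Type) := Operator { dom : set H; op_fun :> H -> H }.

Section Operators.
Context {R : realType} {H : hilbertType R}.
Implicit Types (S T J A B : operator H) (M U P : H -> H) (V : set H).

Definition op_graph T : set (H * H) := [set p | dom T p.1 /\ T p.1 = p.2].

Definition op_eq S T : Prop := op_graph S = op_graph T.

Definition op_linear T : Prop :=
  dom T 0 /\
  forall (a : R[i]) (u v : H), dom T u -> dom T v ->
    dom T (a *: u + v) /\ T (a *: u + v) = a *: T u + T v.

Definition op_ker T : set H := [set u | dom T u /\ T u = 0].

Definition op_total M : operator H := Operator setT M.

Definition op_add S T : operator H := Operator (dom S `&` dom T) (S \+ T).

Definition op_scale (a : R[i]) T : operator H :=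
  Operator (dom T) (fun u => a *: T u).

Definition op_opp T : operator H := Operator (dom T) (fun u => - T u).

Definition op_bij T : Prop := set_bij (dom T) setT T.

Definition op_inv T : H -> H := 'pinv_(fun=> 0) (dom T) T.

(* The graph of the adjoint of T, when T is densely defined. *)
Definition adjoint_graph T : set (H * H) :=
  [set p | forall u, dom T u -> inner (T u) p.1 = inner u p.2].

Definition skew_adjoint T : Prop :=
  [/\ op_linear T, dense (dom T), closed (op_graph T) &
      adjoint_graph T = op_graph (op_opp T)].

Definition unitary U : Prop :=
  (forall u v, inner (U u) (U v) = inner u v) /\ (forall v, exists u, U u = v).

(* U^-1 T U, with domain U^-1 (dom T). *)
Definition op_conj U T : operator H :=
  Operator (U @^-1` dom T) (fun u => op_inv (op_total U) (T (U u))).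

(* z I - T; for a closed T its inverse is automatically bounded as soon as it
   is defined everywhere, so that [op_bij] says that z is in the resolvent
   set. *)
Definition op_pencil (z : R[i]) T : operator H :=
  op_add (op_total (fun u => z *: u)) (op_opp T).

(* Commutation of unbounded operators in the strong sense: all resolvents
   commute (for skew-adjoint operators: all spectral projections commute).
   Requiring A (B u) = B (A u) wherever both sides make sense would be much
   weaker, as the set of such u may be {0}. *)
Definition strongly_commute A B : Prop :=
  forall z w : R[i], op_bij (op_pencil z A) -> op_bij (op_pencil w B) ->
    forall u, op_inv (op_pencil z A) (op_inv (op_pencil w B) u) =
              op_inv (op_pencil w B) (op_inv (op_pencil z A) u).

(* The orthogonal projection onto a closed subspace V. *)
Definition orthproj V (u : H) : H :=
  xget 0 [set p | V p /\ forall v, V v -> inner (u - p) v = 0].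

Record scaling_structure J (S : R -> {linear H -> H})
    (Jmacro Jmicro : operator H) : Prop := {
  scaling_unitary : forall eps, 0 < eps -> unitary (S eps);
  scaling_macro : skew_adjoint Jmacro;
  scaling_micro : skew_adjoint Jmicro;
  scaling_commute : strongly_commute Jmacro Jmicro;
  scaling_conj : forall eps, 0 < eps ->
    op_eq (op_conj (S eps) J)
          (op_add Jmacro (op_scale (eps^-1)%:C Jmicro));
  scaling_ker : forall eps, 0 < eps ->
    forall u, op_ker Jmicro u -> S eps u = u
}.

Definition material_coefficient (Mbox mbox : R) M : Prop :=
  [/\ 0 < Mbox, 0 <= mbox,
      forall u, `|M u| <= Mbox%:C * `|u| &
      forall u, mbox%:C * `|u| ^+ 2 <= 'Re (inner (M u) u)].

Section Homogenization.
Variables (Jmacro Jmicro : operator H).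

Definition P0 : H -> H := orthproj (op_ker Jmicro).

Definition Pi0 : H -> H :=
  orthproj (closure [set u | [/\ op_ker Jmicro u, dom Jmacro u &
                                 op_ker Jmicro (Jmacro u)]]).

Definition Pifluct (u : H) : H := P0 u - Pi0 u.

(* Pi_fluct M Pi_fluct + alpha I *)
Definition fluct_block (alpha : R) M : operator H :=
  op_total (fun u => Pifluct (M (Pifluct u)) + alpha%:C *: u).

Definition M0 (alpha : R) M (u : H) : H :=
  Pi0 (M (Pi0 u)) -
  Pi0 (M (Pifluct (op_inv (fluct_block alpha M) (Pifluct (M (Pi0 u)))))).

End Homogenization.

Definition Meps (S : R -> {linear H -> H}) M (eps : R) (u : H) : H :=
  S eps (M (op_inv (op_total (S eps)) u)).

(* J + M + alpha I *)
Definition evo_op J M (alpha : R) : operator H :=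
  op_add (op_add J (op_total M)) (op_total (fun u => alpha%:C *: u)).

End Operators.

(* Main.v *)
(* Strong commutation makes ker Jmicro reduce Jmacro, so that Pi0 = P0,
   Pi_fluct = 0 and M0 = P0 M P0. Let v = A_0^-1 f, u = A_eps^-1 f and
   g = M v - P0 M v, which is orthogonal to ker Jmicro. Since J and Jmacro
   agree at v, and S_eps fixes v and f, one gets A_eps (u - v) = - S_eps g.
   Moreover g is a limit of vectors Jmicro h with h in dom Jmacro and in
   dom Jmicro (smooth h by the resolvents of Jmacro), and
     A_eps (u - v + eps S_eps h) =
     S_eps (Jmicro h - g + eps (Jmacro h + M h + alpha h)).
   As A_eps is bounded below by alpha, the norm of u - v tends to 0. *)

Require Import Defs.
From HB Require Import structures.
From mathcomp Require Import all_boot all_order all_algebra.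
From mathcomp Require Import all_classical all_reals all_analysis.
From mathcomp Require Import complex ring lra.

Set Implicit Arguments.
Unset Strict Implicit.
Unset Printing Implicit Defensive.

Import Order.TTheory GRing.Theory Num.Theory.
Import numFieldNormedType.Exports.

Local Open Scope classical_set_scope.
Local Open Scope ring_scope.
Local Open Scope complex_scope.

(** * Real parts of norm and inner product *)

Section RealInnerProduct.
Context {R : realType} {H : hilbertType R}.
Implicit Types (u v w : H) (t : R).

(** Norms take values in [R[i]]; their real parts live in the ordered field [R], where [lra] and
    [nra] apply. *)
Definition rnorm u : R := complex.Re `|u|.

Definition rinner u v : R := complex.Re (inner u v).

Definition rscale t u : H := t%:C *: u.

Lemma rnormE u : `|u| = (rnorm u)%:C.
Proof. by rewrite /rnorm RRe_real // normr_real. Qed.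

Lemma rnorm_ge0 u : 0 <= rnorm u.
Proof. by rewrite -lecR -rnormE normr_ge0. Qed.

Lemma rinnerDl u v w : rinner (u + v) w = rinner u w + rinner v w.
Proof. by rewrite /rinner linearDl raddfD. Qed.

Lemma rinnerDr u v w : rinner u (v + w) = rinner u v + rinner u w.
Proof. by rewrite /rinner linearDr raddfD. Qed.

Lemma rinnerNl u v : rinner (- u) v = - rinner u v.
Proof. by rewrite /rinner linearNl raddfN. Qed.

Lemma rinnerNr u v : rinner u (- v) = - rinner u v.
Proof. by rewrite /rinner linearNr raddfN. Qed.

Lemma rinnerBl u v w : rinner (u - v) w = rinner u w - rinner v w.
Proof. by rewrite rinnerDl rinnerNl. Qed.

Lemma rinnerBr u v w : rinner u (v - w) = rinner u v - rinner u w.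
Proof. by rewrite rinnerDr rinnerNr. Qed.

Lemma innerC u v : inner u v = Num.conj (inner v u).
Proof. by rewrite hermC expr0 mul1r. Qed.

Lemma rinnerC u v : rinner u v = rinner v u.
Proof. by rewrite /rinner innerC; case: (inner v u). Qed.

Lemma rinnerZl t u v : rinner (rscale t u) v = t * rinner u v.
Proof.
rewrite /rinner /rscale linearZl_LR /=; case: (inner u v) => a b /=; ring.
Qed.

Lemma rinnerZr t u v : rinner u (rscale t v) = t * rinner u v.
Proof. by rewrite rinnerC rinnerZl rinnerC. Qed.

Lemma rinner_norm u : rinner u u = rnorm u ^+ 2.
Proof. by rewrite /rinner inner_normE rnormE -rmorphXn. Qed.

(** Conjugate-linearity in the second slot moves the imaginary part to the real part at ['i *: v].
    Orthogonality to a complex subspace can therefore be tested with [rinner] alone. *)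
Lemma inner_rinner u v : inner u v = rinner u v +i* rinner u ('i *: v).
Proof.
rewrite /rinner linearZr_LR /=; case: (inner u v) => a b /=.
by congr (_ +i* _); ring.
Qed.

Lemma rnormN u : rnorm (- u) = rnorm u.
Proof. by rewrite /rnorm normrN. Qed.

Lemma rnormBC u v : rnorm (u - v) = rnorm (v - u).
Proof. by rewrite -rnormN opprB. Qed.

Lemma rnorm0 : rnorm (0 : H) = 0.
Proof. by rewrite /rnorm normr0. Qed.

Lemma rnorm_eq0 u : rnorm u = 0 -> u = 0.
Proof. by move=> h; apply: normr0_eq0; rewrite rnormE h. Qed.

Lemma ler_rnormD u v : rnorm (u + v) <= rnorm u + rnorm v.
Proof. by rewrite -lecR rmorphD /= -!rnormE ler_normD. Qed.

Lemma ler_rnormB u v : rnorm (u - v) <= rnorm u + rnorm v.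
Proof. by rewrite (le_trans (ler_rnormD _ _)) // rnormN. Qed.

Lemma ler_rnorm_distD w u v : rnorm (u - v) <= rnorm (u - w) + rnorm (w - v).
Proof. by rewrite -(subrKA w u) ler_rnormD. Qed.

Lemma rnormZ t u : 0 <= t -> rnorm (rscale t u) = t * rnorm u.
Proof.
move=> t0; rewrite {1}/rnorm /rscale normrZ rnormE ger0_norm ?ler0c //.
by rewrite -rmorphM.
Qed.

Lemma rnormDB u v : rnorm (u + v) ^+ 2 + rnorm (u - v) ^+ 2 =
  2 * rnorm u ^+ 2 + 2 * rnorm v ^+ 2.
Proof.
rewrite -!rinner_norm !(rinnerDl, rinnerDr, rinnerNl, rinnerNr); ring.
Qed.

(** Cauchy-Schwarz: the squared norm of |v| u - |u| v expands to 2 |u| |v| (|u| |v| - Re <u, v>),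
    and |u| |v| is cancelled when nonzero. *)
Lemma ler_rinner u v : rinner u v <= rnorm u * rnorm v.
Proof.
have := rinner_norm (rscale (rnorm v) u - rscale (rnorm u) v).
rewrite !(rinnerDl, rinnerDr, rinnerNl, rinnerNr, rinnerZl, rinnerZr).
rewrite (rinnerC v u) !rinner_norm => h.
have := sqr_ge0 (rnorm (rscale (rnorm v) u - rscale (rnorm u) v)); rewrite -h => k.
have [/rnorm_eq0 ->|nu] := eqVneq (rnorm u) 0.
  by rewrite rnorm0 mul0r /rinner linear0l.
have [/rnorm_eq0 ->|nv] := eqVneq (rnorm v) 0.
  by rewrite rnorm0 mulr0 /rinner linear0r.
have u0 : 0 < rnorm u by rewrite lt_neqAle eq_sym nu rnorm_ge0.
have v0 : 0 < rnorm v by rewrite lt_neqAle eq_sym nv rnorm_ge0.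
rewrite -(ler_pM2l (mulr_gt0 u0 v0)); lra.
Qed.

(** Multiplying [u] by the conjugate of [z] makes the inner product equal to |z|^2, so the real
    bound applies and one factor |z| cancels. *)
Lemma normr_inner u v : `|inner u v| <= (rnorm u * rnorm v)%:C.
Proof.
set z := inner u v; pose r := complex.Re `|z|.
have rE : `|z| = r%:C by rewrite RRe_real ?normr_real.
have r0 : 0 <= r by rewrite -lecR -rE normr_ge0.
rewrite rE lecR; have := ler_rinner (Num.conj z *: u) v.
have -> : rinner (Num.conj z *: u) v = r ^+ 2.
  by rewrite /rinner linearZl_LR /= -/z mulrC -normCK rE -rmorphXn.
have -> : rnorm (Num.conj z *: u) = r * rnorm u.
  by rewrite /rnorm normrZ norm_conjC rE rnormE -rmorphM.
rewrite expr2 -mulrA; have [-> _|rn] := eqVneq r 0.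
  by rewrite mulr_ge0 ?rnorm_ge0.
by rewrite ler_pM2l // lt_neqAle eq_sym rn.
Qed.

(** * Closure and completeness with real radii *)

Lemma ler_of_addgt0 (a b : R) : (forall e : R, 0 < e -> a <= b + e) -> a <= b.
Proof. by move=> h; apply/ler_addgt0Pr. Qed.

Lemma closure_rnormP (V : set H) u :
  closure V u <-> forall e : R, 0 < e -> exists2 v, V v & rnorm (u - v) < e.
Proof.
split=> [hu e e0|hu B /nbhs_ballP[e /= e0 eB]].
  have [|v [Vv uv]] := hu (ball u e%:C); first by apply: nbhsx_ballx; rewrite ltcR.
  by exists v => //; move: uv; rewrite -ball_normE /= rnormE ltcR.
(* A positive element of [R[i]] is real, so the radius may be replaced by its real part. *)
have eE : e = (complex.Re e)%:C by rewrite RRe_real // gtr0_real.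
have [|v Vv uv] := hu (complex.Re e); first by rewrite -ltcR -eE.
exists v; split => //; apply: eB; rewrite -ball_normE /= rnormE eE ltcR //.
Qed.

Lemma closed_rnormP (V : set H) :
  closed V <->
  forall u, (forall e : R, 0 < e -> exists2 v, V v & rnorm (u - v) < e) -> V u.
Proof.
split=> [cV u /closure_rnormP/cV //|hV u /closure_rnormP/hV //].
Qed.

Lemma rnorm_complete (x : nat -> H) :
  (forall e : R, 0 < e -> exists N, forall m n, (N <= m)%N -> (N <= n)%N ->
    rnorm (x m - x n) < e) ->
  exists l, forall e : R, 0 < e -> exists N, forall n, (N <= n)%N ->
    rnorm (l - x n) < e.
Proof.
move=> hx.
have : cvg (x @ \oo).
  apply/cauchy_cvgP/cauchyP => e e0.
  have eE : e = (complex.Re e)%:C by rewrite RRe_real // gtr0_real.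
  have [|N hN] := hx (complex.Re e); first by rewrite -ltcR -eE.
  exists (x N); exists N => // n /= Nn.
  by rewrite -ball_normE /= rnormE eE ltcR; exact: hN.
move=> /cvg_ex[l /cvgrPdist_lt hl]; exists l => e e0.
have [|N _ hN] := hl e%:C; first by rewrite ltcR.
by exists N => n /hN /=; rewrite rnormE ltcR.
Qed.

End RealInnerProduct.

(** * Orthogonal projections *)

Section Projection.
Context {R : realType} {H : hilbertType R}.
Implicit Types (u v w y : H) (t : R) (V : set H).

Definition subspace V :=
  V 0 /\ forall (a : R[i]) u v, V u -> V v -> V (a *: u + v).

Lemma subspaceZ V a u : subspace V -> V u -> V (a *: u).
Proof. by move=> [V0 Vl] Vu; rewrite -[_ *: _]addr0; exact: Vl. Qed.

Lemma subspaceD V u v : subspace V -> V u -> V v -> V (u + v).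
Proof. by move=> [V0 Vl] Vu; rewrite -[X in X + _]scale1r; exact: Vl. Qed.

Lemma subspaceN V u : subspace V -> V u -> V (- u).
Proof. by move=> sV Vu; rewrite -scaleN1r; exact: subspaceZ. Qed.

Lemma subspaceB V u v : subspace V -> V u -> V v -> V (u - v).
Proof. by move=> sV Vu Vv; apply: subspaceD => //; exact: subspaceN. Qed.

Lemma archi_inv (c e : R) : 0 <= c -> 0 < e ->
  exists N : nat, forall n, (N <= n)%N -> c / n.+1%:R < e.
Proof.
move=> c0 e0; exists (Num.truncn (c / e)) => n Nn.
rewrite ltr_pdivrMr ?ltr0n // mulrC -ltr_pdivrMr //.
rewrite (lt_le_trans (truncnS_gt _)) // ler_nat ltnS //.
Qed.

(** A minimizing sequence for the distance is Cauchy by the parallelogram law, because midpoints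
    stay in [V]; its limit is in [V] by closedness. *)
Lemma exists_nearest V u : closed V -> subspace V ->
  exists2 p, V p & forall v, V v -> rnorm (u - p) <= rnorm (u - v).
Proof.
move=> /closed_rnormP cV sV.
pose D := [set rnorm (u - v) | v in V]; pose d := inf D.
have infD : has_inf D.
  split; first by exists (rnorm (u - 0)), 0 => //; case: sV.
  by exists 0 => _ [v _ <-]; exact: rnorm_ge0.
have dle v : V v -> d <= rnorm (u - v).
  by move=> Vv; apply: ge_inf; [case: infD | exists v].
have d0 : 0 <= d.
  by apply: lb_le_inf; [case: infD | move=> _ [v _ <-]; exact: rnorm_ge0].
have /choice[x hx] : forall n : nat,
    exists v, V v /\ rnorm (u - v) < d + n.+1%:R^-1.
  move=> n; have [|_ [v Vv <-] lt_v] := @inf_adherent _ D n.+1%:R^-1 _ infD.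
    by rewrite invr_gt0 ltr0n.
  by exists v.
have [|l hl] := @rnorm_complete _ _ x.
  (* The midpoint is at distance at least d from [u], so two terms beyond [N] have squared distance
     at most 4 (d + s)^2 - 4 d^2 = 8 d s + 4 s^2, which is at most (8 d + 4) s since s <= 1. *)
  move=> e e0; have [||N hN] := @archi_inv (8 * d + 4) (e ^+ 2); [lra|nra|].
  exists N => m n Nm Nn.
  pose s : R := N.+1%:R^-1.
  have s0 : 0 < s by rewrite invr_gt0 ltr0n.
  have s1 : s <= 1 by rewrite invf_le1 ?ltr0n // ler1n.
  have se : (8 * d + 4) * s < e ^+ 2 by exact: hN.
  have near k : (N <= k)%N -> rnorm (u - x k) < d + s.
    move=> Nk; apply: (lt_le_trans (hx k).2).
    by rewrite lerD2l lef_pV2 ?posrE ?ltr0n // ler_nat ltnS.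
  have := rnormDB (u - x m) (u - x n).
  have -> : u - x m + (u - x n) = rscale 2 (u - rscale 2^-1 (x m + x n)).
    rewrite /rscale scalerBr scalerA -rmorphM mulfV ?pnatr_eq0 //.
    rewrite rmorph1 scale1r rmorphMn /= rmorph1 mulr2n scalerDl !scale1r.
    by rewrite opprD addrACA.
  have -> : u - x m - (u - x n) = x n - x m.
    by rewrite opprB addrC addrA subrK.
  rewrite rnormZ // (rnormBC (x n)) => pl.
  have dm : d <= rnorm (u - rscale 2^-1 (x m + x n)).
    exact/dle/(subspaceZ _ sV)/(subspaceD sV (hx m).1 (hx n).1).
  have := lerXn2r 2 _ _ (ltW (near m Nm)); have := lerXn2r 2 _ _ (ltW (near n Nn)).
  have := lerXn2r 2 _ _ dm; rewrite !nnegrE !rnorm_ge0 d0 (addr_ge0 d0 (ltW s0)).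
  move=> /(_ isT isT) q2 /(_ isT isT) n2 /(_ isT isT) m2.
  rewrite ltNge; apply/negP => ea.
  have := lerXn2r 2 _ _ ea; rewrite !nnegrE rnorm_ge0 (ltW e0) => /(_ isT isT) e2.
  nra.
have ul : rnorm (u - l) <= d.
  apply: ler_of_addgt0 => e e0.
  have e2 : 0 < e / 2 by lra.
  have [N1 hN1] := hl _ e2; have [N2 hN2] := archi_inv ler01 e2.
  pose k := maxn N1 N2.
  have := hN1 k (leq_maxl _ _); have := hN2 k (leq_maxr _ _).
  have := (hx k).2; have := ler_rnorm_distD (x k) u l.
  rewrite (rnormBC (x k) l) div1r; move: (_^-1) => s *; lra.
exists l; last by move=> v Vv; exact: le_trans ul (dle _ Vv).
apply: cV => e e0; have [N hN] := hl e e0.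
by exists (x N); [case: (hx N) | exact: hN].
Qed.

Lemma exists_orthproj V u : closed V -> subspace V ->
  exists p, V p /\ forall v, V v -> inner (u - p) v = 0.
Proof.
move=> cV sV; have [p Vp hp] := exists_nearest u cV sV; exists p; split=> //.
suff h v : V v -> rinner (u - p) v = 0.
  by move=> v Vv; rewrite inner_rinner !h //; exact: subspaceZ.
move=> Vv; pose c := rinner (u - p) v; rewrite -/c.
(* Compare [p] with [p + rscale (s * c) v]. Since s |v|^2 = 1 - s, minimality becomes s c^2 (1 + s)
   <= 0, which forces c = 0 and needs no division by |v|. *)
pose s := (rnorm v ^+ 2 + 1)^-1.
have v0 := sqr_ge0 (rnorm v).
have s0 : 0 < s by rewrite invr_gt0; lra.
have sv : s * (rnorm v ^+ 2 + 1) = 1 by rewrite mulVf; lra.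
have := hp (p + rscale (s * c) v).
have /[swap]/[apply] : V (p + rscale (s * c) v).
  by apply: subspaceD => //; exact: subspaceZ.
rewrite -(@ler_pXn2r _ 2) ?nnegrE ?rnorm_ge0 // -!rinner_norm.
rewrite [in X in _ <= X](_ : u - _ = u - p - rscale (s * c) v); last first.
  by rewrite opprD addrA.
rewrite [X in _ <= X]rinnerBl !(rinnerBr _ _ (rscale _ _)) !rinnerZl !rinnerZr.
rewrite (rinnerC v) -/c (rinner_norm v) => k.
have : s * c ^+ 2 * (1 + s) <= 0 by nra.
by move=> {}k; apply/eqP; rewrite -sqrf_eq0 eq_le sqr_ge0 andbT; nra.
Qed.

Lemma orthprojP V u : closed V -> subspace V ->
  V (orthproj V u) /\ forall v, V v -> inner (u - orthproj V u) v = 0.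
Proof.
move=> cV sV; rewrite /orthproj; case: xgetP => [p _ //|h].
by have [p /h] := exists_orthproj u cV sV.
Qed.

Lemma orthproj_unique V u p : closed V -> subspace V -> V p ->
  (forall v, V v -> inner (u - p) v = 0) -> orthproj V u = p.
Proof.
move=> cV sV Vp hp; have [Vq hq] := orthprojP u cV sV.
apply/subr0_eq/rnorm_eq0/eqP; rewrite -sqrf_eq0 -rinner_norm /rinner.
have Vqp := subspaceB sV Vq Vp.
have e : orthproj V u - p = u - p - (u - orthproj V u).
  by rewrite opprB [RHS]addrC addrA subrK.
by rewrite [X in inner X _]e linearBl /= hp // hq // subrr.
Qed.

Lemma orthproj_id V u : closed V -> subspace V -> V u -> orthproj V u = u.
Proof.
by move=> cV sV Vu; apply: orthproj_unique => // v _; rewrite subrr linear0l.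
Qed.

Lemma orthproj_linear V (a : R[i]) u v : closed V -> subspace V ->
  orthproj V (a *: u + v) = a *: orthproj V u + orthproj V v.
Proof.
move=> cV sV; have [Vu hu] := orthprojP u cV sV.
have [Vv hv] := orthprojP v cV sV; apply: orthproj_unique => //.
  by case: sV => _; apply.
move=> w Vw; rewrite opprD addrACA -scalerBr linearPl /= hu // hv //.
by rewrite mulr0 addr0.
Qed.

Lemma rinner_orthproj V u v : closed V -> subspace V -> V v ->
  rinner (orthproj V u) v = rinner u v.
Proof.
move=> cV sV Vv; have [_ hu] := orthprojP u cV sV.
by rewrite -[in RHS](subrK (orthproj V u) u) rinnerDl {2}/rinner hu // add0r.
Qed.

Lemma rnorm_orthproj V u : closed V -> subspace V ->
  rnorm (orthproj V u) <= rnorm u.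
Proof.
move=> cV sV; have [Vu _] := orthprojP u cV sV.
have := ler_rinner u (orthproj V u).
rewrite -(rinner_orthproj u cV sV Vu) rinner_norm.
have := rnorm_ge0 (orthproj V u); have := rnorm_ge0 u.
by move: (rnorm _) (rnorm _) => a b *; rewrite leNgt; apply/negP => ?; nra.
Qed.

(** If [phi] is not zero, take [y] nonzero and orthogonal to its kernel: u - (phi u / phi y) y lies
    in the kernel, and pairing it with [y] yields the representing vector. This later supplies
    values of the adjoint of a bounded operator. *)
Lemma riesz (phi : H -> R[i]) (C : R) :
  (forall (a : R[i]) u v, phi (a *: u + v) = a * phi u + phi v) ->
  (forall u, `|phi u| <= (C * rnorm u)%:C) ->
  exists z, forall u, phi u = inner u z.
Proof.
move=> lphi bphi.
have phi0 : phi 0 = 0.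
  by apply/normr0_eq0/eqP; rewrite eq_le normr_ge0 (le_trans (bphi _)) // rnorm0 mulr0.
have phiZ a u : phi (a *: u) = a * phi u by rewrite -[_ *: _]addr0 lphi phi0 addr0.
have phiB u v : phi (u - v) = phi u - phi v.
  by rewrite addrC -scaleN1r lphi mulN1r addrC.
pose K := [set u | phi u = 0].
have sK : subspace K.
  by split=> // a u v; rewrite /K /= => u0 v0; rewrite lphi u0 v0 mulr0 addr0.
have cK : closed K.
  apply/closed_rnormP => u hu; apply/normr0_eq0/eqP.
  rewrite -[`|_|]RRe_real ?normr_real //; set r := complex.Re _.
  have r0 : 0 <= r by rewrite -lecR /r RRe_real ?normr_real ?normr_ge0.
  suff rle : r <= 0.
    by have /eqP -> : r == 0; [rewrite eq_le rle | rewrite rmorph0].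
  apply: ler_of_addgt0 => e e0; rewrite add0r.
  (* The sign of [C] is unknown, hence a divisor that is positive in all cases. *)
  have Cp : 0 < `|C| + 1 by have := normr_ge0 C; lra.
  have [v Kv uv] := hu (e / (`|C| + 1)) (divr_gt0 e0 Cp).
  have : r <= C * rnorm (u - v).
    by rewrite -lecR /r RRe_real ?normr_real // -[phi u]subr0 -Kv -phiB.
  move/le_trans; apply.
  move: uv; rewrite ltr_pdivlMr // => uv.
  by have := ler_norm C; have := rnorm_ge0 (u - v); nra.
have [h|] := pselect (forall u, phi u = 0).
  by exists 0 => u; rewrite h linear0r.
move/existsNP => [x /eqP nx].
have [Kp hp] := orthprojP x cK sK; set y := x - _ in hp.
have py : phi y = phi x by rewrite phiB Kp subr0.
have y0 : inner y y != 0.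
  by rewrite dnorm_eq0; apply: contraNneq nx => y0; rewrite -py y0 phi0.
(* The conjugate compensates the conjugate-linearity of the second slot. *)
exists (Num.conj (phi y / inner y y) *: y) => u.
rewrite linearZr_LR /= conjCK.
have : K (u - (phi u / phi y) *: y).
  by rewrite /K /= phiB phiZ divfK ?subrr // py.
move=> /hp; rewrite innerC => /eqP; rewrite conjC_eq0 linearBl linearZl_LR subr_eq0.
move=> /eqP -> /=; field; rewrite y0 py nx //.
Qed.

End Projection.

(** * Accretive perturbations of skew-adjoint operators *)

Section SkewAdjoint.
Context {R : realType} {H : hilbertType R}.
Implicit Types (S T A B : operator H) (u v w y : H).

Lemma op_bijP T : (forall y, exists2 u, dom T u & T u = y) ->
  (forall u v, dom T u -> dom T v -> T u = T v -> u = v) -> op_bij T.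
Proof.
move=> surjT injT; split=> //; first by move=> u v; rewrite !inE; exact: injT.
by move=> y _; have [u Tu <-] := surjT y; exists u.
Qed.

Lemma op_invK T u : op_bij T -> dom T u -> op_inv T (T u) = u.
Proof. by move=> [_ injT _] Tu; apply: pinvKV => //; rewrite inE. Qed.

Lemma op_inv_spec T y : op_bij T -> dom T (op_inv T y) /\ T (op_inv T y) = y.
Proof.
move=> bT; have [_ _ /(_ y I)[u Tu <-]] := bT.
by rewrite op_invK.
Qed.

Section Linear.
Variable T : operator H.
Hypothesis lT : op_linear T.

Lemma op_linear0 : dom T 0 /\ T 0 = 0.
Proof.
case: lT => T0 lin; split=> //; have [_] := lin 1 _ _ T0 T0.
by rewrite !scale1r addr0 => /(congr1 (fun x => x - T 0)); rewrite addrK subrr.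
Qed.

Lemma op_linearZ (a : R[i]) u : dom T u ->
  dom T (a *: u) /\ T (a *: u) = a *: T u.
Proof.
move=> Tu; have [T0 T00] := op_linear0; have [_ lin] := lT.
by have := lin a _ _ Tu T0; rewrite T00 !addr0.
Qed.

Lemma op_linearD u v : dom T u -> dom T v ->
  dom T (u + v) /\ T (u + v) = T u + T v.
Proof.
by move=> Tu Tv; have [_ lin] := lT; have := lin 1 _ _ Tu Tv; rewrite !scale1r.
Qed.

Lemma op_linearB u v : dom T u -> dom T v ->
  dom T (u - v) /\ T (u - v) = T u - T v.
Proof.
move=> Tu Tv; have [Nv TNv] := op_linearZ (-1) Tv.
by have := op_linearD Tu Nv; rewrite TNv !scaleN1r.
Qed.

Lemma op_ker_subspace : subspace (op_ker T).
Proof.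
split; first exact: op_linear0.
move=> a u v [Tu u0] [Tv v0]; have [_ lin] := lT.
by have [dl el] := lin a _ _ Tu Tv; split => //; rewrite el u0 v0 scaler0 addr0.
Qed.

End Linear.

Section Skew.
Variable T : operator H.
Hypothesis sT : skew_adjoint T.

Lemma skew_linear : op_linear T.
Proof. by case: sT. Qed.

Lemma skew_inner u v : dom T u -> dom T v -> inner (T u) v = - inner u (T v).
Proof.
case: sT => _ _ _ aT Tu Tv; have : op_graph (op_opp T) (v, - T v) by [].
by rewrite -aT => /(_ u Tu) /= ->; rewrite linearNr.
Qed.

Lemma skew_rinner u : dom T u -> rinner (T u) u = 0.
Proof.
move=> Tu; suff : rinner (T u) u = - rinner (T u) u by lra.
by rewrite {2}rinnerC /rinner skew_inner // raddfN.
Qed.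

(** The maximality half of skew-adjointness: an identity tested weakly on [dom T] places [v] in the
    domain. *)
Lemma skew_graph v w : (forall u, dom T u -> inner (T u) v = - inner u w) ->
  dom T v /\ T v = w.
Proof.
case: sT => _ _ _ aT h; have : adjoint_graph T (v, - w).
  by move=> u Tu /=; rewrite h // linearNr.
by rewrite aT => -[/= Tv /oppr_inj].
Qed.

Lemma skew_graph_closed u w :
  (forall e : R, 0 < e ->
     exists v, [/\ dom T v, rnorm (u - v) < e & rnorm (w - T v) < e]) ->
  dom T u /\ T u = w.
Proof.
case: sT => _ _ cT _ h.
have: op_graph T (u, w); last by move=> [].
apply: cT => B -[[B1 B2] /= [/nbhs_ballP[e1 /= e10 s1] /nbhs_ballP[e2 /= e20 s2]] sB].
have eE1 : e1 = (complex.Re e1)%:C by rewrite RRe_real // gtr0_real.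
have eE2 : e2 = (complex.Re e2)%:C by rewrite RRe_real // gtr0_real.
have [|v [Tv uv wv]] := h (Num.min (complex.Re e1) (complex.Re e2)).
  by rewrite lt_min -!ltcR -eE1 -eE2 e10 e20.
exists (v, T v); split=> //; apply: sB; split => /=.
  apply: s1; rewrite -ball_normE /= rnormE eE1 ltcR.
  by rewrite (lt_le_trans uv) // ge_min lexx.
apply: s2; rewrite -ball_normE /= rnormE eE2 ltcR.
by rewrite (lt_le_trans wv) // ge_min lexx orbT.
Qed.

Lemma op_ker_closed : closed (op_ker T).
Proof.
apply/closed_rnormP => u hu; apply: skew_graph_closed => e e0.
have [v [Tv v0] uv] := hu e e0.
by exists v; split=> //; rewrite v0 subrr rnorm0.
Qed.

Section Accretive.
Variables (N : H -> H) (C a : R).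
Hypotheses (lN : forall (b : R[i]) u v, N (b *: u + v) = b *: N u + N v)
  (bN : forall u, rnorm (N u) <= C * rnorm u)
  (a0 : 0 < a) (aN : forall u, a * rnorm u ^+ 2 <= rinner (N u) u).

(** Since Re <T u, u> = 0, the form of [T + N] at [u] is at least a |u|^2 and, by Cauchy-Schwarz, at
    most |T u + N u| |u|. *)
Lemma skew_accretive_bound u : dom T u -> a * rnorm u <= rnorm (T u + N u).
Proof.
move=> Tu; have := ler_rinner (T u + N u) u; rewrite rinnerDl skew_rinner // add0r.
move/(le_trans (aN u)); have [-> _|un] := eqVneq (rnorm u) 0.
  by rewrite mulr0 rnorm_ge0.
by rewrite expr2 mulrA ler_pM2r // lt_neqAle eq_sym un rnorm_ge0.
Qed.

Lemma skew_accretive_inj u v : dom T u -> dom T v ->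
  T u + N u = T v + N v -> u = v.
Proof.
move=> Tu Tv e; apply/subr0_eq/rnorm_eq0/eqP; rewrite eq_le rnorm_ge0 andbT.
have [Tuv Tuvw] := op_linearB skew_linear Tu Tv.
have := skew_accretive_bound Tuv; rewrite Tuvw.
have -> : N (u - v) = N u - N v by rewrite addrC -scaleN1r lN scaleN1r addrC.
by rewrite addrACA -opprD e subrr rnorm0 pmulr_rle0.
Qed.

(* The range of [T + N] is closed because [T + N] is bounded from below; a
   vector [y] orthogonal to it satisfies [T y = N^* y], so that
   [0 = Re <T y, y> = Re <N y, y>]. *)
Lemma skew_accretive_surj y : exists2 u, dom T u & T u + N u = y.
Proof.
have C0 : 0 <= `|C| by [].
have bN' u : rnorm (N u) <= `|C| * rnorm u.
  by rewrite (le_trans (bN u)) // ler_wpM2r ?rnorm_ge0 ?ler_norm.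
pose L u := T u + N u; pose V := [set y | exists2 u, dom T u & L u = y].
have lL (b : R[i]) u v : dom T u -> dom T v ->
    dom T (b *: u + v) /\ L (b *: u + v) = b *: L u + L v.
  case: skew_linear => _ lin Tu Tv; have [? e] := lin b u v Tu Tv; split=> //.
  by rewrite /L e lN scalerDr addrACA.
have NB u v : N (u - v) = N u - N v by rewrite addrC -scaleN1r lN scaleN1r addrC.
have sV : subspace V.
  split.
    have [T0 T00] := op_linear0 skew_linear; exists 0 => //.
    by rewrite /L T00 -[X in N X](subrr 0) NB subrr addr0.
  move=> b _ _ [u Tu <-] [v Tv <-]; have [? <-] := lL b u v Tu Tv.
  by exists (b *: u + v).
have cV : closed V.
  apply/closed_rnormP => z hz.
  have /choice[x hx] : forall n : nat,
      exists u, dom T u /\ rnorm (z - L u) < n.+1%:R^-1.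
    move=> n; have [|_ [u Tu <-] zu] := hz n.+1%:R^-1; last by exists u.
    by rewrite invr_gt0 ltr0n.
  have [|l hl] := @rnorm_complete _ _ x.
    move=> e e0; have ae0 : 0 < a * e / 2 by rewrite divr_gt0 // mulr_gt0.
    have [N0 hN0] := archi_inv ler01 ae0.
    exists N0 => m n /hN0 m0 /hN0 n0; rewrite -(ltr_pM2l a0).
    have [Tmn Tmn'] := op_linearB skew_linear (hx m).1 (hx n).1.
    apply: (le_lt_trans (skew_accretive_bound Tmn)).
    rewrite Tmn' NB addrACA -opprD -/(L _) -/(L _).
    apply: (le_lt_trans (ler_rnorm_distD z _ _)).
    rewrite (rnormBC (L _) z); have := (hx m).2; have := (hx n).2.
    move: m0 n0; rewrite !div1r.
    move: m.+1%:R^-1 n.+1%:R^-1 => s t *; lra.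
  (* Along the sequence T x_k = L x_k - N x_k tends to z - N l, and the graph of [T] is closed. *)
  have [|Tl Tle] := @skew_graph_closed l (z - N l).
    move=> e e0; have c1 : 0 < (`|C| + 1) by lra.
    have e1 : 0 < e / 2 by lra.
    have e2 : 0 < e / 2 / (`|C| + 1) by apply: divr_gt0.
    have [N1 hN1] := hl _ e2; have [N2 hN2] := archi_inv ler01 e1.
    pose k := maxn N1 N2.
    have lk := hN1 k (leq_maxl _ _); have k2 := hN2 k (leq_maxr _ _).
    move: lk; rewrite ltr_pdivlMr // => lk; have lk0 := rnorm_ge0 (l - x k).
    exists (x k); split; [exact: (hx k).1 | by nra |].
    have -> : z - N l - T (x k) = z - L (x k) - N (l - x k).
      by rewrite NB /L opprB opprD !addrA subrK addrAC.
    apply: (le_lt_trans (ler_rnormB _ _)).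
    have := bN' (l - x k); have := (hx k).2; move: k2; rewrite div1r.
    move: k.+1%:R^-1 => s *; lra.
  by exists l => //; rewrite /L Tle subrK.
have [Vp hp] := orthprojP y cV sV.
suff -> : y = orthproj V y by [].
apply/subr0_eq; move: hp; set q := y - _ => hq.
(* The vector [z] is the value at [q] of the adjoint of [N]. *)
have [||z hz] := @riesz _ _ (fun u => inner (N u) q) (`|C| * rnorm q).
- by move=> b u v; rewrite lN linearPl.
- move=> u; apply: (le_trans (normr_inner _ _)).
  by rewrite lecR [leRHS]mulrAC ler_wpM2r ?rnorm_ge0.
have [|Tq Tqz] := @skew_graph q z.
  move=> u Tu; apply/eqP; rewrite -addr_eq0 -hz /= -linearDl /= innerC conjC_eq0.
  by apply/eqP/hq; exists u.
have := skew_rinner Tq; rewrite Tqz rinnerC /rinner -hz /= -/(rinner _ _) => Nq0.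
apply: rnorm_eq0; apply/eqP; rewrite -sqrf_eq0 eq_le sqr_ge0 andbT.
by rewrite -(pmulr_rle0 _ a0) -Nq0.
Qed.

End Accretive.
End Skew.
End SkewAdjoint.

(** * Resolvents and commutation *)

Section Resolvent.
Context {R : realType} {H : hilbertType R}.
Implicit Types (T : operator H) (u v w : H) (t : R).

Lemma subspace_closure (V : set H) : subspace V -> subspace (closure V).
Proof.
move=> sV; split; first by apply: subset_closure; case: sV.
move=> a u v /closure_rnormP hu /closure_rnormP hv; apply/closure_rnormP => e e0.
pose r := complex.Re `|a|.
have rE : `|a| = r%:C by rewrite RRe_real ?normr_real.
have r0 : 0 <= r by rewrite -lecR -rE normr_ge0.
have e1 : 0 < e / 2 by lra.
have r1 : 0 < r + 1 by lra.
have [u' Vu' uu'] := hu (e / 2 / (r + 1)) (divr_gt0 e1 r1).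
have [v' Vv' vv'] := hv (e / 2) e1.
exists (a *: u' + v'); first by case: sV => _; apply.
rewrite opprD addrACA -scalerBr; apply: (le_lt_trans (ler_rnormD _ _)).
have -> : rnorm (a *: (u - u')) = r * rnorm (u - u').
  by rewrite /rnorm normrZ rE rnormE -rmorphM.
move: uu'; rewrite ltr_pdivlMr // => uu'.
have := rnorm_ge0 (u - u'); nra.
Qed.

Lemma rscale_linear t (b : R[i]) u v :
  rscale t (b *: u + v) = b *: rscale t u + rscale t v.
Proof. by rewrite /rscale scalerDr !scalerA mulrC. Qed.

(* [(T + t I)^-1], written through the pencil [- t I - T]. *)
Definition resolvent T t w : H := - op_inv (op_pencil (- t%:C) T) w.

Section Skew.
Variables (T : operator H) (t : R).
Hypotheses (sT : skew_adjoint T) (t0 : 0 < t).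

(** The pencil is the negative of [T + t I], and t I is accretive with constant t. This makes strong
    commutation applicable at the points -t. *)
Lemma op_pencil_bij : op_bij (op_pencil (- t%:C) T).
Proof.
have bt u : rnorm (rscale t u) <= t * rnorm u by rewrite rnormZ // ltW.
have at_ u : t * rnorm u ^+ 2 <= rinner (rscale t u) u.
  by rewrite rinnerZl rinner_norm.
apply: op_bijP => [y|u v [_ Tu] [_ Tv]] /=.
  have [u Tu hu] := skew_accretive_surj sT (rscale_linear t) bt t0 at_ (- y).
  by exists u => //; rewrite scaleNr -opprD addrC hu opprK.
rewrite !scaleNr -!opprD => /oppr_inj; rewrite addrC [RHS]addrC.
exact: (skew_accretive_inj sT (rscale_linear t) t0 at_ Tu Tv).
Qed.

Lemma resolventP w :
  dom T (resolvent T t w) /\ T (resolvent T t w) + rscale t (resolvent T t w) = w.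
Proof.
have [[_ Tw] hw] := op_inv_spec w op_pencil_bij.
have [Tn Tnw] := op_linearZ (skew_linear sT) (-1) Tw.
move: Tn Tnw; rewrite !scaleN1r -/(resolvent T t w) => Tn ->; split=> //.
by rewrite -[RHS]hw /= addrC /resolvent /rscale scalerN scaleNr.
Qed.

Lemma resolvent_unique u w : dom T u -> T u + rscale t u = w ->
  resolvent T t w = u.
Proof.
move=> Tu hu; have [Tw hw] := resolventP w.
apply: (skew_accretive_inj sT (rscale_linear t) t0 _ Tw Tu); last by rewrite hu.
by move=> v; rewrite rinnerZl rinner_norm.
Qed.

Lemma resolvent_linear (a : R[i]) u v :
  resolvent T t (a *: u + v) = a *: resolvent T t u + resolvent T t v.
Proof.
have [Tu hu] := resolventP u; have [Tv hv] := resolventP v.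
have [_ lin] := skew_linear sT; have [Tl el] := lin a _ _ Tu Tv.
apply: resolvent_unique => //.
by rewrite el rscale_linear addrACA -scalerDr hu hv.
Qed.

Lemma resolventD u v : resolvent T t (u + v) = resolvent T t u + resolvent T t v.
Proof. by have := resolvent_linear 1 u v; rewrite !scale1r. Qed.

Lemma resolventB u v : resolvent T t (u - v) = resolvent T t u - resolvent T t v.
Proof. by rewrite addrC -scaleN1r resolvent_linear scaleN1r addrC. Qed.

Lemma resolventN u : resolvent T t (- u) = - resolvent T t u.
Proof.
by rewrite -[X in resolvent _ _ X]sub0r -(subrr u) !resolventB subrr sub0r.
Qed.

Lemma rnorm_resolvent w : t * rnorm (resolvent T t w) <= rnorm w.
Proof.
have [Tw hw] := resolventP w; rewrite -[in leRHS]hw.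
by apply: skew_accretive_bound => // v; rewrite rinnerZl rinner_norm.
Qed.

(** On the domain, x - t (T + t)^-1 x = (T + t)^-1 T x has norm at most |T x| / t; the remainder u -
    x costs a factor 2 because t (T + t)^-1 is a contraction. *)
Lemma resolvent_dist u x : dom T x ->
  rnorm (u - rscale t (resolvent T t u)) <= 2 * rnorm (u - x) + rnorm (T x) / t.
Proof.
move=> Tx; have [Trx hrx] := resolventP x.
have [Ttrx etrx] := op_linearZ (skew_linear sT) t%:C Trx.
have [Td ed] := op_linearB (skew_linear sT) Tx Ttrx.
have key : t * rnorm (x - rscale t (resolvent T t x)) <= rnorm (T x).
  have <- : T (x - rscale t (resolvent T t x)) +
      rscale t (x - rscale t (resolvent T t x)) = T x.
    rewrite /rscale ed etrx [t%:C *: (x - _)]scalerBr addrACA -opprD -scalerDr.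
    by rewrite hrx addrK.
  by apply: skew_accretive_bound => // v; rewrite rinnerZl rinner_norm.
have -> : u - rscale t (resolvent T t u) =
    (u - x) - rscale t (resolvent T t (u - x)) + (x - rscale t (resolvent T t x)).
  by rewrite resolventB /rscale scalerBr [RHS]addrAC subrKA opprB addrA subrK.
apply: (le_trans (ler_rnormD _ _)); apply: lerD; last first.
  by rewrite ler_pdivlMr // mulrC.
apply: (le_trans (ler_rnormB _ _)); rewrite rnormZ ?(ltW t0) //.
have := rnorm_resolvent (u - x); lra.
Qed.

End Skew.

Lemma resolvent_approx T u (e : R) : skew_adjoint T -> 0 < e ->
  exists2 t, 0 < t & rnorm (u - rscale t (resolvent T t u)) < e.
Proof.
move=> sT e0; have [x Tx ux] : exists2 x, dom T x & rnorm (u - x) < e / 4.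
  case: sT => _ dT _ _; have e4 : 0 < (e / 4)%:C by rewrite ltcR; lra.
  have [||x [ux Tx]] := dT (ball u (e / 4)%:C); [|exact: ball_open|].
    by exists u; exact: ballxx.
  by exists x => //; move: ux; rewrite -ball_normE /= rnormE ltcR.
(* The density error counts twice, giving less than e / 2, and this [t] brings |T x| / t below e /
   2; the added 1 keeps [t] positive when T x = 0. *)
pose t := 4 * (rnorm (T x) + 1) / e.
have n0 := rnorm_ge0 (T x).
have t0 : 0 < t by rewrite divr_gt0 //; lra.
exists t => //; apply: (le_lt_trans (resolvent_dist sT t0 u Tx)).
have te : t * e = 4 * (rnorm (T x) + 1) by rewrite divfK ?gt_eqF.
have : rnorm (T x) / t < e / 2 by rewrite ltr_pdivrMr //; lra.
lra.
Qed.

(** * Consequences of strong commutation *)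

Section Commute.
Variables A B : operator H.
Hypotheses (sA : skew_adjoint A) (sB : skew_adjoint B)
  (cAB : strongly_commute A B).

Lemma resolventC s t w : 0 < s -> 0 < t ->
  resolvent A s (resolvent B t w) = resolvent B t (resolvent A s w).
Proof.
move=> s0 t0; rewrite {2}/resolvent {3}/resolvent !resolventN // /resolvent.
by rewrite !opprK cAB //; exact: op_pencil_bij.
Qed.

(** Kernel vectors of [B] are the fixed points of (B + 1)^-1, a property preserved by every operator
    commuting with that resolvent. *)
Lemma resolvent_op_ker t u : 0 < t -> op_ker B u -> op_ker B (resolvent A t u).
Proof.
move=> t0 [Bu u0]; have l1 := @ltr01 R.
have uE : resolvent B 1 u = u.
  by apply: resolvent_unique => //; rewrite u0 add0r /rscale rmorph1 scale1r.
have := resolventP sB l1 (resolvent A t u).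
rewrite -resolventC // uE => -[By]; rewrite /rscale rmorph1 scale1r => h.
split=> //; exact: (addIr _ (etrans h (esym (add0r _)))).
Qed.

(** Write u = (B + 1)^-1 (B u + u) and exchange the two resolvents. *)
Lemma resolvent_commute t u : 0 < t -> dom B u ->
  dom B (resolvent A t u) /\ B (resolvent A t u) = resolvent A t (B u).
Proof.
move=> t0 Bu; have l1 := @ltr01 R.
have uE : resolvent B 1 (B u + rscale 1 u) = u by exact: resolvent_unique.
have := resolventP sB l1 (resolvent A t (B u + rscale 1 u)).
rewrite -resolventC // uE /rscale rmorph1 !scale1r resolventD // => -[By h].
by split=> //; exact: (addIr _ h).
Qed.

(** For [u] in the kernel put w = (A + t)^-1 u. Then t w is in the kernel, A (t w) = t (u - t w) is
    too, and t w approximates [u]. *)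
Lemma closure_op_ker_macro :
  closure [set u | [/\ op_ker B u, dom A u & op_ker B (A u)]] = op_ker B.
Proof.
have sK := op_ker_subspace (skew_linear sB).
apply/seteqP; split=> u.
  move=> /closure_rnormP hu; apply: (closed_rnormP _).1 (op_ker_closed sB) _ _.
  by move=> e /hu[v [Kv _ _] uv]; exists v.
move=> Ku; apply/closure_rnormP => e e0.
have [t t0 ut] := resolvent_approx u sA e0.
have [Aw hw] := resolventP sA t0 u.
have Kw := resolvent_op_ker t0 Ku.
have [Atw etw] := op_linearZ (skew_linear sA) t%:C Aw.
exists (rscale t (resolvent A t u)) => //; split => //; first exact: subspaceZ.
rewrite /rscale etw; apply: subspaceZ => //.
rewrite (_ : A _ = u - rscale t (resolvent A t u)); last first.
  by rewrite -[X in _ = X - _]hw addrK.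
by apply: subspaceB => //; exact: subspaceZ.
Qed.

(** The orthogonal complement of ker B is contained in the closure of the range of [B]; the
    approximate preimage is then smoothed by a resolvent of [A], which commutes with [B], to bring
    it into [dom A]. *)
Lemma range_micro_approx g (e : R) :
  (forall v, op_ker B v -> inner g v = 0) -> 0 < e ->
  exists h, [/\ dom A h, dom B h & rnorm (g - B h) < e].
Proof.
move=> hg e0; pose V := [set B h | h in dom B].
have lB := skew_linear sB.
have sV : subspace V.
  split; first by have [B0 B00] := op_linear0 lB; exists 0.
  move=> a _ _ [u Bu <-] [v Bv <-]; have [_ lin] := lB.
  by have [Bl <-] := lin a u v Bu Bv; exists (a *: u + v).
have [Wp hp] := orthprojP g (@closed_closure _ V) (subspace_closure sV).
set p := orthproj _ g in Wp hp.
have Kq : op_ker B (g - p).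
  apply: (skew_graph sB) => u Bu; rewrite linear0r oppr0 innerC hp ?conjC0 //.
  by apply: subset_closure; exists u.
(* As g - p lies in ker B, it is orthogonal to [g] by hypothesis, and to [p] by projection. *)
have /eqP : inner (g - p) (g - p) = 0.
  by rewrite linearBl /= hg // innerC hp // conjC0 subrr.
rewrite dnorm_eq0 subr_eq0 => /eqP gp; move: Wp; rewrite -gp => /closure_rnormP.
have e2 : 0 < e / 2 by lra.
move=> /(_ _ e2)[_ [h0 Bh0 <-] gh0].
(* The parameter is tuned to [B h0] rather than [h0], since only the image under [B] must stay
   close. *)
have [t t0 ht] := resolvent_approx (B h0) sA e2.
have [Ar _] := resolventP sA t0 h0.
have [Br eBr] := resolvent_commute t0 Bh0.
have [Ah _] := op_linearZ (skew_linear sA) t%:C Ar.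
have [Bh eBh] := op_linearZ lB t%:C Br.
exists (rscale t (resolvent A t h0)); split => //.
rewrite /rscale eBh eBr; apply: (le_lt_trans (ler_rnorm_distD (B h0) _ _)).
by rewrite [ltRHS]splitr ltrD.
Qed.

End Commute.
End Resolvent.

(** * Homogenization *)

Section Evolution.
Context {R : realType} {H : hilbertType R}.
Implicit Types (J : operator H) (N : H -> H) (u v w : H).

Section EvoOp.
Variables (J : operator H) (N : H -> H) (C alpha : R).
Hypotheses (sJ : skew_adjoint J)
  (lN : forall (b : R[i]) u v, N (b *: u + v) = b *: N u + N v)
  (bN : forall u, rnorm (N u) <= C * rnorm u)
  (aN : forall u, 0 <= rinner (N u) u) (a0 : 0 < alpha).

(** Absorbing alpha into the bounded part turns accretivity of [N] into strict accretivity with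
    constant alpha. *)
Let N' u := N u + alpha%:C *: u.

Let lN' (b : R[i]) u v : N' (b *: u + v) = b *: N' u + N' v.
Proof. by rewrite /N' lN -/(rscale alpha _) rscale_linear addrACA -scalerDr. Qed.

Let aN' u : alpha * rnorm u ^+ 2 <= rinner (N' u) u.
Proof.
by rewrite /N' rinnerDl -/(rscale alpha u) rinnerZl rinner_norm lerDr.
Qed.

Lemma evo_op_bij : op_bij (evo_op J N alpha).
Proof.
have bN' u : rnorm (N' u) <= (C + alpha) * rnorm u.
  apply: (le_trans (ler_rnormD _ _)).
  by rewrite -/(rscale alpha u) rnormZ ?(ltW a0) // mulrDl lerD2r.
apply: op_bijP => [y|u v [[Ju _] _] [[Jv _] _]] /=.
  have [u Ju <-] := skew_accretive_surj sJ lN' bN' a0 aN' y.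
  by exists u => //; rewrite /N' addrA.
by rewrite -!addrA; exact: (skew_accretive_inj sJ lN' a0 aN' Ju Jv).
Qed.

Lemma evo_op_bound u : dom J u -> alpha * rnorm u <= rnorm (evo_op J N alpha u).
Proof.
by move=> Ju; rewrite /= -addrA; exact: (skew_accretive_bound sJ aN' Ju).
Qed.

End EvoOp.

(** * Unitary maps and their inverses *)

Section Unitary.
Variable U : {linear H -> H}.
Hypothesis hU : unitary U.

Lemma unitary_rinner u v : rinner (U u) (U v) = rinner u v.
Proof. by rewrite /rinner hU.1. Qed.

Lemma unitary_rnorm u : rnorm (U u) = rnorm u.
Proof.
apply/eqP; rewrite -(@eqrXn2 _ 2) ?rnorm_ge0 // -!rinner_norm unitary_rinner //.
Qed.

Lemma unitary_bij : op_bij (op_total U).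
Proof.
apply: op_bijP => [y|u v _ _ /= e]; first by have [u <-] := hU.2 y; exists u.
by apply/subr0_eq/rnorm_eq0; rewrite -unitary_rnorm linearB /= e subrr rnorm0.
Qed.

Lemma unitaryK u : op_inv (op_total U) (U u) = u.
Proof. exact: (op_invK unitary_bij). Qed.

Lemma unitaryVK u : U (op_inv (op_total U) u) = u.
Proof. exact: (op_inv_spec u unitary_bij).2. Qed.

End Unitary.
End Evolution.

(** * The homogenized problem and the error estimate *)

Section Homogenization.
Context {R : realType} {H : hilbertType R}.
Variables (J : operator H) (S : R -> {linear H -> H})
  (Jmacro Jmicro : operator H) (M : {linear H -> H}) (Mbox mbox alpha : R).
Hypotheses (hJ : skew_adjoint J) (hS : scaling_structure J S Jmacro Jmicro)
  (hM : material_coefficient Mbox mbox M) (halpha : 0 < alpha).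

Let sA : skew_adjoint Jmacro. Proof. by case: hS. Qed.
Let sB : skew_adjoint Jmicro. Proof. by case: hS. Qed.
Let cAB : strongly_commute Jmacro Jmicro. Proof. by case: hS. Qed.
Let P := P0 Jmicro.
Let cK := op_ker_closed sB.
Let sK := op_ker_subspace (skew_linear sB).

Lemma Pi0_P0 : Pi0 Jmacro Jmicro = P0 Jmicro.
Proof. by rewrite /Pi0 closure_op_ker_macro. Qed.

Lemma Pifluct0 u : Pifluct Jmacro Jmicro u = 0.
Proof. by rewrite /Pifluct Pi0_P0 subrr. Qed.

Lemma M0E u : M0 Jmacro Jmicro alpha M u = P (M (P u)).
Proof.
by rewrite /M0 Pi0_P0 Pifluct0 linear0 [P0 _ 0](orthproj_id cK sK sK.1) subr0.
Qed.

Lemma material_bound u : rnorm (M u) <= Mbox * rnorm u.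
Proof. by case: hM => _ _ /(_ u); rewrite !rnormE -rmorphM lecR. Qed.

Lemma material_accretive u : 0 <= rinner (M u) u.
Proof.
case: hM => _ m0 _ /(_ u); rewrite rnormE -rmorphXn -rmorphM -complexRe lecR.
by apply: le_trans; rewrite mulr_ge0 ?sqr_ge0.
Qed.

Lemma fluct_block_bij : op_bij (fluct_block Jmacro Jmicro alpha M).
Proof.
have a0 : alpha%:C != 0 by rewrite gt_eqF // ltcR.
apply: op_bijP => [y|u v _ _] /=.
  by exists (alpha%:C^-1 *: y) => //; rewrite Pifluct0 add0r scalerA mulfV ?scale1r.
by rewrite !Pifluct0 !add0r; exact: scalerI.
Qed.

Lemma Meps_linear eps (b : R[i]) u v : 0 < eps ->
  Meps S M eps (b *: u + v) = b *: Meps S M eps u + Meps S M eps v.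
Proof.
move=> e0; have hU := scaling_unitary hS e0.
rewrite /Meps -{1}(unitaryVK hU u) -{1}(unitaryVK hU v) -linearP unitaryK //.
by rewrite !linearP.
Qed.

Lemma Meps_bound eps u : 0 < eps -> rnorm (Meps S M eps u) <= Mbox * rnorm u.
Proof.
move=> e0; have hU := scaling_unitary hS e0.
rewrite /Meps unitary_rnorm // (le_trans (material_bound _)) //.
by rewrite -(unitary_rnorm hU) unitaryVK.
Qed.

Lemma Meps_accretive eps u : 0 < eps -> 0 <= rinner (Meps S M eps u) u.
Proof.
move=> e0; have hU := scaling_unitary hS e0.
by rewrite -{2}(unitaryVK hU u) unitary_rinner // material_accretive.
Qed.

Lemma M0_linear (b : R[i]) u v : M0 Jmacro Jmicro alpha M (b *: u + v) =
  b *: M0 Jmacro Jmicro alpha M u + M0 Jmacro Jmicro alpha M v.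
Proof. by rewrite !M0E /P /P0 orthproj_linear // linearP orthproj_linear. Qed.

Lemma M0_bound u : rnorm (M0 Jmacro Jmicro alpha M u) <= Mbox * rnorm u.
Proof.
rewrite M0E (le_trans (rnorm_orthproj _ cK sK)) // (le_trans (material_bound _)) //.
by case: hM => m0 _ _ _; rewrite ler_wpM2l ?(ltW m0) // rnorm_orthproj.
Qed.

(** Self-adjointness of the projection moves it to the second slot: <P M P u, u> = <M P u, P u>. *)
Lemma M0_accretive u : 0 <= rinner (M0 Jmacro Jmicro alpha M u) u.
Proof.
have [Ku _] := orthprojP u cK sK; have [KM _] := orthprojP (M (P u)) cK sK.
rewrite M0E rinnerC -(rinner_orthproj u cK sK KM) rinnerC.
by rewrite rinner_orthproj // material_accretive.
Qed.

Lemma evo_op_eps_bij eps : 0 < eps -> op_bij (evo_op J (Meps S M eps) alpha).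
Proof.
move=> e0; apply: (evo_op_bij hJ _ (fun u => Meps_bound u e0)) => // [b u v|u].
- exact: Meps_linear.
- exact: Meps_accretive.
Qed.

Lemma evo_op0_bij : op_bij (evo_op J (M0 Jmacro Jmicro alpha M) alpha).
Proof.
exact: (evo_op_bij hJ M0_linear M0_bound M0_accretive halpha).
Qed.

(** The scaling relation compares graphs, so it yields the membership in [dom J] together with the
    value. *)
Lemma scaling_graph eps h : 0 < eps -> dom Jmacro h -> dom Jmicro h ->
  dom J (S eps h) /\
  J (S eps h) = S eps (Jmacro h + (eps^-1)%:C *: Jmicro h).
Proof.
move=> e0 Ah Bh.
have : op_graph (op_add Jmacro (op_scale (eps^-1)%:C Jmicro))
  (h, Jmacro h + (eps^-1)%:C *: Jmicro h) by [].
rewrite -(scaling_conj hS e0) => -[/= Jh <-]; split=> //.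
by rewrite unitaryVK //; exact: (scaling_unitary hS e0).
Qed.

(* A solution [v] satisfies [(Jmacro + alpha I) v = f - P M P v], whose
   right-hand side lies in the kernel of [Jmicro], which the resolvents of
   [Jmacro] preserve; on this kernel [J] and [Jmacro] agree. *)
Lemma macroscopic_solution f : op_ker Jmicro f -> exists v,
  [/\ op_ker Jmicro v, dom Jmacro v, Jmacro v + P (M v) + alpha%:C *: v = f &
      op_inv (evo_op J (M0 Jmacro Jmicro alpha M) alpha) f = v].
Proof.
(* The equation is first solved with [Jmacro] in place of [J]. *)
move=> Kf; have := evo_op_bij sA M0_linear M0_bound M0_accretive halpha.
move=> /(op_inv_spec f)[]; set v := op_inv _ _ => -[[Av _] _] /= hv.
rewrite M0E in hv.
have KM x : op_ker Jmicro (P x) by have [] := orthprojP x cK sK.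
have Kv : op_ker Jmicro v.
  have <- : resolvent Jmacro alpha (f - P (M (P v))) = v.
    by apply: resolvent_unique => //; rewrite -hv addrAC addrK.
  by apply: resolvent_op_ker => //; exact: subspaceB.
have Pv : P v = v by exact: orthproj_id.
rewrite Pv in hv.
have KA : op_ker Jmicro (Jmacro v).
  rewrite (_ : Jmacro v = f - alpha%:C *: v - P (M v)); last first.
    by rewrite -hv addrK addrK.
  by do 2!apply: subspaceB => //; exact: subspaceZ.
(* Use the scaling relation at eps = 1: both [v] and [Jmacro v] are in the kernel, hence fixed by
   [S 1], and the micro term vanishes. *)
have [dv ev] : dom J v /\ J v = Jmacro v.
  have [Bv v0] := Kv; have := scaling_graph ltr01 Av Bv.
  by rewrite v0 scaler0 addr0 !(scaling_ker hS ltr01).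
exists v; split=> //.
rewrite -[X in op_inv _ X]hv -ev -[in P (M v)]Pv -M0E.
exact: (op_invK evo_op0_bij).
Qed.

(** The bound separates an error independent of eps, the defect of [Jmicro h] as an approximation of
    g = M v - P (M v), from a term linear in eps. Thus [h] can be fixed before eps. *)
Lemma resolvent_difference_bound f v h eps : 0 < eps ->
  op_ker Jmicro v -> dom Jmacro v -> Jmacro v + P (M v) + alpha%:C *: v = f ->
  op_ker Jmicro f -> dom Jmacro h -> dom Jmicro h ->
  alpha * rnorm (op_inv (evo_op J (Meps S M eps) alpha) f - v) <=
  rnorm (M v - P (M v) - Jmicro h) +
  eps * (rnorm (Jmacro h + M h + alpha%:C *: h) + alpha * rnorm h).
Proof.
move=> e0 Kv Av hv Kf Ah Bh; set L := evo_op _ _ _.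
have hU := scaling_unitary hS e0.
have [[[Ju _] _] Lu] := op_inv_spec f (evo_op_eps_bij e0).
rewrite -/L in Ju Lu *; set u := op_inv L f in Ju Lu *.
have LL (b : R[i]) x y : dom J x -> dom J y -> L (b *: x + y) = b *: L x + L y.
  move=> Jx Jy; have [_ lin] := skew_linear hJ; have [_ e] := lin b _ _ Jx Jy.
  rewrite /L /= e Meps_linear // -/(rscale alpha _) rscale_linear !scalerDr.
  by rewrite [X in X + _ = _]addrACA [LHS]addrACA.
have [Bv v0] := Kv; have Sv := scaling_ker hS e0 Kv.
have [dSv eSv] := scaling_graph e0 Av Bv; rewrite Sv in dSv eSv.
have [dSh eSh] := scaling_graph e0 Ah Bh.
have LS x : L (S eps x) = J (S eps x) + S eps (M x + alpha%:C *: x).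
  by rewrite /L /= /Meps unitaryK // linearD linearZ addrA.
have KP : op_ker Jmicro (P (M v)) by have [] := orthprojP (M v) cK sK.
have Lv : L v = S eps (f + (M v - P (M v))).
  rewrite -{1}Sv LS Sv eSv -linearD -hv v0 scaler0 addr0; congr (S eps _).
  by rewrite [X in _ = X + _]addrAC [RHS]addrACA subrr addr0 addrA addrAC.
(* The corrector is scaled by eps so that the factor 1 / eps in front of [Jmicro] cancels and
   [Jmicro h] meets g at order one. *)
pose x := eps%:C *: S eps h + (u - v).
have [dx _] := op_linearB (skew_linear hJ) Ju dSv.
have Lx : L x = S eps (eps%:C *: (Jmacro h + M h + alpha%:C *: h) -
    (M v - P (M v) - Jmicro h)).
  have e1 : eps%:C * eps^-1%:C = 1 :> R[i].
    by rewrite -rmorphM mulfV ?gt_eqF ?rmorph1.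
  have Luv : L (u - v) = S eps (- (M v - P (M v))).
    rewrite addrC -scaleN1r LL // Lu Lv scaleN1r addrC -{1}(scaling_ker hS e0 Kf).
    by rewrite -linearB opprD addrA subrr sub0r.
  rewrite LL // Luv LS eSh -linearD -linearP; congr (S eps _).
  rewrite (addrAC (Jmacro h)) [in LHS]scalerDr scalerA e1 scale1r addrA.
  by rewrite [in RHS]opprB addrA.

have dJx : dom J x by have [_ lin] := skew_linear hJ; have [] := lin eps%:C _ _ dSh dx.
have := evo_op_bound alpha hJ (fun y => Meps_accretive y e0) dJx.
rewrite -/L Lx unitary_rnorm // => bx.
have {}bx := le_trans bx (ler_rnormB _ _).
rewrite -/(rscale eps _) rnormZ ?(ltW e0) // in bx.
(* Removing the corrector costs eps |h|, as [S eps] is an isometry. *)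
have -> : u - v = x - rscale eps (S eps h) by rewrite /x [X in _ = X - _]addrC addrK.
have := ler_rnormB x (rscale eps (S eps h)); rewrite rnormZ ?(ltW e0) //.
rewrite unitary_rnorm // => /(ler_wpM2l (ltW halpha)); lra.
Qed.

End Homogenization.

Theorem theorem2p11 (R : realType) (H : hilbertType R)
    (J : operator H) (S : R -> {linear H -> H})
    (Jmacro Jmicro : operator H) (M : {linear H -> H})
    (Mbox mbox alpha : R)
    (hJ : skew_adjoint J)
    (hS : scaling_structure J S Jmacro Jmicro)
    (hM : material_coefficient Mbox mbox M)
    (halpha : 0 < alpha)
    (f : H) (hf : range (Pi0 Jmacro Jmicro) f) :
  let A_eps (eps : R) := evo_op J (Meps S M eps) alpha in
  let A_0 := evo_op J (M0 Jmacro Jmicro alpha M) alpha in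
  [/\ op_bij (fluct_block Jmacro Jmicro alpha M),
      forall eps, 0 < eps -> op_bij (A_eps eps),
      op_bij A_0 &
      (fun eps : R =>
         Pi0 Jmacro Jmicro (op_inv (A_eps eps) f - op_inv A_0 f))
        @ 0^'+ --> (0 : H)].
Proof.
move=> A_eps A_0; split.
- exact: (fluct_block_bij M hS halpha).
- by move=> eps e0; exact: (evo_op_eps_bij hJ hS hM).
- exact: (evo_op0_bij hJ hS hM).
have sB := scaling_micro hS.
have cK := op_ker_closed sB; have sK := op_ker_subspace (skew_linear sB).
have {hf} Kf : op_ker Jmicro f.
  by case: hf => y _ <-; rewrite (Pi0_P0 hS); case: (orthprojP y cK sK).
have [v [Kv Av hv ->]] := macroscopic_solution hJ hS hM halpha Kf.
rewrite (Pi0_P0 hS); apply/cvgrPdist_lt => e0 e0p.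
have eE : e0 = (complex.Re e0)%:C by rewrite RRe_real // gtr0_real.
have e : 0 < complex.Re e0 by rewrite -ltcR -eE.
move: (complex.Re e0) eE e => e -> {e0 e0p} e0.
have ae : 0 < alpha * e / 2 by rewrite divr_gt0 // mulr_gt0.
have orth k : op_ker Jmicro k -> inner (M v - P0 Jmicro (M v)) k = 0.
  by case: (orthprojP (M v) cK sK) => _; apply.
have [h [Ah Bh gh]] :=
  range_micro_approx (scaling_macro hS) sB (scaling_commute hS) orth ae.
set K := rnorm (Jmacro h + M h + alpha%:C *: h) + alpha * rnorm h.
have K0 : 0 <= K by rewrite addr_ge0 ?mulr_ge0 ?rnorm_ge0 // ltW.
(* Here [K] may vanish, so [K + 1] serves as divisor; [K] depends on [h] but not on eps. *)
have K1 : 0 < K + 1 by lra.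
near=> eps.
have eps0 : 0 < eps by near: eps; exact: nbhs_right_gt.
have epsK : eps * (K + 1) < alpha * e / 2.
  rewrite -ltr_pdivlMr //; near: eps; apply: nbhs_right_lt.
  exact: divr_gt0.
(* The projection is a contraction, so the unprojected difference is estimated instead. *)
rewrite sub0r rnormE ltcR rnormN (le_lt_trans (rnorm_orthproj _ cK sK)) //.
rewrite -(ltr_pM2l halpha).
have b := resolvent_difference_bound hJ hS hM halpha eps0 Kv Av hv Kf Ah Bh.
apply: (le_lt_trans b).
rewrite -/K; nra.
Unshelve. all: by end_near.
Qed.
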